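(* Consider a triangular array (as described in the context, with $m(n)=\lfloor n^\alpha\rfloor$, $\alpha>1$) satisfying the following condition: for every $\varepsilon>0$ there exists $M(\varepsilon)<\infty$ such that for all large enough $n$, all $F_n\in\mathcal{F}_n$ and all $\beta\in B^n$, if $L_{F_n}(\beta)>L_{F_n}(\beta^*_{F_n})+2\varepsilon$, then $E_{F_n}\min(l(\beta,Z),M(\varepsilon))>L_{F_n}(\beta^*_{F_n})+\varepsilon$. Let $k_n$ be positive integers with $k_n=o(n/\log n)$ and let $R_n>0$ satisfy $\log(R_n)=o(n)$. Assume: (i) For every sequence $F_n\in\mathcal{F}_n$, $n=1,2,\ldots$, the parameter $\beta^*_{F_n}$ belongs to a $k_n$-dimensional cube centered at the origin with Euclidean ($k_n$-dimensional) volume $R_n$. (ii) For every $\varepsilon>0$ there exist $\delta>0$ and $\gamma>0$ (not depending on $n$) such that for all $n$, all $F_n\in\mathcal{F}_n$ and all $\beta,\beta'\in A(k_n)$, if $\|\beta-\beta'\|_2<\delta n^{-\gamma}$ then $|L_{F_n}(\beta)-L_{F_n}(\beta')|<\varepsilon$. Then for every $\varepsilon>0$ there exists a sequence of procedures $\hat\beta_n$ such that $$\sup_{F_n\in\mathcal{F}_n}P_{F_n}\big(L_{F_n}(\hat\beta_n)-L_{F_n}(\beta^*_{F_n})>\varepsilon\big)\to 0\quad\text{as } n\to\infty,$$ and, consequently, there exists a sequence of procedures that is persistent with respect to $B^n$.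
   Context: Triangular array: for each $n$ there is a dimension $m=m(n)=\lfloor n^{\alpha}\rfloor$ for a fixed $\alpha>1$; a collection $\mathcal{F}_n$ of distributions of a random vector $Z=(Y,X_1,\ldots,X_m)$; a set of parameters $B^n\subset\mathbb{R}^{m}$ indexing the predictors $g_\beta=g_\beta(X_1,\ldots,X_m)$, $\beta\in B^n$, available at stage $n$; and a nonnegative prediction loss $l$, with $l(\beta,Z)$ denoting $l(Y,g_\beta(X_1,\ldots,X_m))$. At stage $n$ one observes i.i.d. vectors $Z^1,\ldots,Z^n$ with distribution $F_n$, where $F_n\in\mathcal{F}_n$ is unknown. Risk: $L_F(\beta)=E_F\,l(\beta,Z)$. The best predictor is $\beta^*_{F_n}=\arg\min_{\beta\in B^n}L_{F_n}(\beta)$ (assumed to exist). If the minimizer is not unique, a condition imposed on it is understood to hold for one of the minimizers. A procedure at stage $n$ is a (measurable) function $\hat\beta_n=\hat\beta_n(Z^1,\ldots,Z^n)$ with values in $B^n$. A sequence of procedures is persistent with respect to $B^n$ if for every $\varepsilon>0$, $\sup_{F_n\in\mathcal{F}_n}P_{F_n}(L_{F_n}(\hat\beta_n)-L_{F_n}(\beta^*_{F_n})>\varepsilon)\to0$ as $n\to\infty$, where $P_{F_n}$ is the probability when $Z^1,\ldots,Z^n$ are i.i.d. $F_n$. $A(k)$ denotes the set of predictors, identified with their parameters $\beta$, having at most $k$ nonzero entries (among those available at stage $n$). A $k$-dimensional cube centered at $c\in\mathbb{R}^m$ is a set of the form $\{c+v: v_j=0\text{ for }j\notin S,\ |v_j|\le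 r\text{ for }j\in S\}$ with $S\subset\{1,\ldots,m\}$, $|S|=k$, $r>0$; its volume is $(2r)^k$. The set $S$ may depend on $F_n$. *)

(* Defs.v *)
From HB Require Import structures.
From mathcomp Require Import all_boot all_order all_algebra.
From mathcomp Require Import all_classical all_reals all_analysis.

Set Implicit Arguments.
Unset Strict Implicit.
Unset Printing Implicit Defensive.

Import Order.TTheory GRing.Theory Num.Theory.
Import numFieldNormedType.Exports.

Local Open Scope classical_set_scope.
Local Open Scope ring_scope.

Section iid_sample.
Context d (T : measurableType d) (R : realType).

Definition tcons n (x : T * n.-tuple T) : n.+1.-tuple T :=
  [tuple of x.1 :: x.2].

Lemma measurable_tcons n : measurable_fun setT (@tcons n).
Proof. exact: measurable_cons. Qed.

HB.instance Definition _ n :=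
  isMeasurableFun.Build _ _ _ _ (@tcons n) (@measurable_tcons n).

(* The law of an i.i.d. sample of size n from F, that is the n-fold product of
   F on n-tuples (see sample_law_box). *)
Fixpoint sample_law (F : probability T R) n : probability (n.-tuple T) R :=
  if n is n'.+1
  then distribution (F \x sample_law F n')%E (@tcons n')
  else dirac [tuple].

Lemma sample_law_box (F : probability T R) n (A : 'I_n -> set T) :
  (forall i, measurable (A i)) ->
  sample_law F n [set z | forall i, A i (tnth z i)] = (\prod_(i < n) F (A i))%E.
Proof.
elim: n A => [|n IH] A mA.
  by rewrite big_ord0 /= diracE mem_set// => -[].
rewrite big_ord_recl -IH//=.
rewrite /distribution /pushforward.
have -> : @tcons n @^-1` [set z | forall i, A i (tnth z i)] =
    A ord0 `*` [set z | forall i, A (lift ord0 i) (tnth z i)].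
  apply/seteqP; split => -[x z] /=.
    move=> H; split; first exact: (H ord0).
    by move=> i; have := H (lift ord0 i); rewrite /tcons tnthS.
  move=> [Hx Hz] i; have [j ->|->] := unliftP ord0 i; last exact: Hx.
  by rewrite /tcons tnthS.
rewrite product_measure1E//.
rewrite (_ : [set z | _] =
  \bigcap_(i in [set: 'I_n]) ((@tnth _ T)^~ i @^-1` A (lift ord0 i))).
  apply: fin_bigcap_measurable => [|i _]; first exact: finite_finset.
  rewrite -[X in measurable X]setTI.
  exact: measurable_tnth.
by apply/seteqP; split => z /= H i; [move=> _; exact: H | exact: (H i I)].
Qed.

End iid_sample.

(* An observation Z = (Y, X_1, ..., X_m), with the Borel sets of R^(1 + m). *)
Notation obs R m := (measurableTypeR R * m.-tuple (measurableTypeR R))%type.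

Section persistence.
Context {R : realType}.

Definition array_dim (alpha : R) (n : nat) : nat := Num.truncn (n%:R `^ alpha).

(* l(beta, z) = l(y, g_beta(x)) *)
Definition pred_loss m (l : R -> R -> R)
    (g : 'rV[R]_m -> m.-tuple (measurableTypeR R) -> R)
    (b : 'rV[R]_m) (z : obs R m) : R :=
  l z.1 (g b z.2).

(* Risks take values in [0, +oo]: the loss need not be integrable. *)
Definition risk m (lb : 'rV[R]_m -> obs R m -> R) (F : probability (obs R m) R)
    (b : 'rV[R]_m) : \bar R :=
  'E_F[lb b].

Definition trunc_risk m (lb : 'rV[R]_m -> obs R m -> R) (M : R)
    (F : probability (obs R m) R) (b : 'rV[R]_m) : \bar R :=
  'E_F[fun z => Num.min (lb b z) M].

Definition is_argmin m (B : set 'rV[R]_m) (L : 'rV[R]_m -> \bar R)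
    (b : 'rV[R]_m) : Prop :=
  B b /\ forall b', B b' -> (L b <= L b')%E.

Definition l2norm m (v : 'rV[R]_m) : R := Num.sqrt (\sum_j v 0 j ^+ 2).

Definition sparse m (B : set 'rV[R]_m) (k : nat) : set 'rV[R]_m :=
  [set b | B b /\ (#|[pred j | (b 0 j != 0)%R]| <= k)%N].

Definition cube m (c : 'rV[R]_m) (S : {set 'I_m}) (r : R) : set 'rV[R]_m :=
  [set c + v | v in [set v : 'rV[R]_m |
    forall j, (j \notin S -> v 0 j = 0) /\ (j \in S -> `|v 0 j| <= r)]].

Definition is_cube m (k : nat) (c : 'rV[R]_m) (vol : R) (C : set 'rV[R]_m) :=
  exists (S : {set 'I_m}) (r : R),
    [/\ #|S| = k, 0 < r, C = cube c S r & (2 * r) ^+ k = vol].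

(* The first disjunct lets two infinite risks count as close; without it,
   oo - oo = -oo would force every risk compared to be finite. *)
Definition ereal_close (e : R) (a b : \bar R) : Prop :=
  a = b \/ (`|a - b| < e%:E)%E.

(* Coordinatewise measurability is measurability for the Borel sets of R^m. *)
Definition is_procedure n m (B : set 'rV[R]_m)
    (bhat : n.-tuple (obs R m) -> 'rV[R]_m) : Prop :=
  (forall z, B (bhat z)) /\
  forall j, measurable_fun setT (fun z => bhat z 0 j).

Definition excess_event n m (L : 'rV[R]_m -> \bar R) (bstar : 'rV[R]_m)
    (e : R) (bhat : n.-tuple (obs R m) -> 'rV[R]_m) : set (n.-tuple (obs R m)) :=
  [set z | (L (bhat z) - L bstar > e%:E)%E].

(* L_F need not be Borel in beta, so the measurability of the events whose
   probabilities are taken is part of the property. *)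
Definition excess_vanishes (m : nat -> nat)
    (FF : forall n, set (probability (obs R (m n)) R))
    (L : forall n, probability (obs R (m n)) R -> 'rV[R]_(m n) -> \bar R)
    (bstar : forall n, probability (obs R (m n)) R -> 'rV[R]_(m n)) (e : R)
    (bhat : forall n, n.-tuple (obs R (m n)) -> 'rV[R]_(m n)) : Prop :=
  (forall n F, (0 < n)%N -> FF n F ->
     measurable (excess_event (L n F) (bstar n F) e (bhat n))) /\
  ereal_sup [set sample_law F n (excess_event (L n F) (bstar n F) e (bhat n))
            | F in FF n] @[n --> \oo] --> 0%E.

Definition persistent (m : nat -> nat)
    (FF : forall n, set (probability (obs R (m n)) R))
    (L : forall n, probability (obs R (m n)) R -> 'rV[R]_(m n) -> \bar R)
    (bstar : forall n, probability (obs R (m n)) R -> 'rV[R]_(m n))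
    (bhat : forall n, n.-tuple (obs R (m n)) -> 'rV[R]_(m n)) : Prop :=
  forall e : R, 0 < e -> excess_vanishes FF L bstar e bhat.

End persistence.

(* Main.v *)
Require Import Defs.
From HB Require Import structures.
From mathcomp Require Import all_boot all_order all_algebra.
From mathcomp Require Import all_classical all_reals all_analysis.
From mathcomp Require Import measurable_realfun ring lra.

Set Implicit Arguments.
Unset Strict Implicit.
Unset Printing Implicit Defensive.

Import Order.TTheory GRing.Theory Num.Theory.
Import numFieldNormedType.Exports.

Local Open Scope classical_set_scope.
Local Open Scope ring_scope.

(** Put a finite grid on each of the coordinate cubes that can contain the best
predictor: with mesh of order n^-gamma / k_n every point of such a cube lies,
in Euclidean distance, within delta n^-gamma of any other point of its cell, so
hypothesis (ii) makes the risk nearly constant on the sparse predictors of one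
cell.  Keeping one predictor of B^n from each nonempty cell gives a finite net
(sparse_cube_net) which, whatever F in F_n is, contains some b1 with
L_F(b1) <= L_F(b*_F) + e/8.

The procedure minimizes over this net the empirical mean of the loss truncated
at M.  Truncation is harmless in the two directions that matter: it only
lowers the risk of b1, while the truncation condition says that a predictor
with L_F(b) > L_F(b*_F) + e still has truncated risk above L_F(b*_F) + e/2.
Hence a bad predictor can win only if one of the truncated empirical means is
off by at least e/8, and since truncated losses are bounded, a Chernoff bound
makes each such event exponentially unlikely, with probability at most
exp(- c n) where c depends on e and M alone (sample_law_deviation_le).  A
union bound over the net (erm_bad_le, erm_over_net) leaves
(1 + size of the net) exp(- c n).

The net has at most (m (2r/h + 1))^k points, where h is the mesh and 2r the
side of the cube, so (2r)^k = R_n.  Its logarithm is at most a constant plus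
k_n O(log n) + max(0, log R_n), and this is o(n) by the growth hypotheses
(net_card_subexponential): the exponential rate wins.

These procedures depend on e.  A persistent sequence uses at stage n the
largest j <= n for which the procedure built for 1/(j+1) already has failure
probability at most 1/(j+1) uniformly over F_n (persistent_diagonal). *)

(** * Deviations of sums over an i.i.d. sample *)

Section deviation.
Context d (T : measurableType d) (R : realType).
Implicit Types (F : probability T R) (X : T -> R).

Lemma measurable_fun_tnth n X (i : 'I_n) : measurable_fun setT X ->
  measurable_fun setT (fun z : n.-tuple T => X (tnth z i)).
Proof.
by move=> mX; apply: (measurableT_comp mX); exact: measurable_tnth.
Qed.

Lemma measurable_fun_sum_tnth n X : measurable_fun setT X ->
  measurable_fun setT (fun z : n.-tuple T => \sum_(i < n) X (tnth z i)).
Proof.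
by move=> mX; apply: measurable_sum => i; exact: measurable_fun_tnth.
Qed.

Lemma measurable_fun_prod_tnth n X : measurable_fun setT X ->
  measurable_fun setT (fun z : n.-tuple T => \prod_(i < n) X (tnth z i)).
Proof.
by move=> mX; apply: measurable_prod => i _; exact: measurable_fun_tnth.
Qed.

(** The moment generating function of a sum of independent terms factors; the
inequality is all that the Chernoff bound needs.  Tonelli splits off the first
observation. *)
Lemma integral_sample_law_prod_le F n X (a : R) :
  measurable_fun setT X -> (forall x, 0 <= X x) ->
  (\int[F]_x (X x)%:E <= a%:E)%E ->
  (\int[sample_law F n]_z (\prod_(i < n) X (tnth z i))%:E <= (a ^+ n)%:E)%E.
Proof.
move=> mX X0 Xa.
have a0 : 0 <= a.
  by rewrite -lee_fin (le_trans _ Xa)// integral_ge0// => x _; rewrite lee_fin.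
have p0 k (z : k.-tuple T) : 0 <= \prod_(i < k) X (tnth z i).
  exact: prodr_ge0.
elim: n => [|n IH].
  rewrite [sample_law F 0]/= integral_dirac//; last first.
    by apply/measurable_EFinP; exact: measurable_fun_prod_tnth.
  by rewrite diracT mul1e big_ord0 expr0.
rewrite [sample_law F n.+1]/= ge0_integral_distribution//; last 2 first.
- by apply/measurable_EFinP; exact: measurable_fun_prod_tnth.
- by move=> z; rewrite lee_fin.
under eq_integral => z _.
  rewrite /= big_ord_recl tnth0.
  under eq_bigr do rewrite tnthS.
  over.
rewrite fubini_tonelli1/=; last 2 first.
- apply/measurable_EFinP; apply: measurable_funM.
    by apply: (measurableT_comp mX); exact: measurable_fst.
  apply: (measurableT_comp (measurable_fun_prod_tnth mX)).
  exact: measurable_snd.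
- by move=> z; rewrite lee_fin mulr_ge0 ?p0.
rewrite /fubini_F/=.
under eq_integral => x _.
  under eq_integral do rewrite EFinM.
  rewrite ge0_integralZl_EFin//; last 2 first.
  - by move=> z _; rewrite lee_fin p0.
  - by apply/measurable_EFinP; exact: measurable_fun_prod_tnth.
  over.
set I := (\int[sample_law F n]_y _)%E in IH *.
have I0 : (0 <= I)%E by apply: integral_ge0 => z _; rewrite lee_fin p0.
rewrite ge0_integralZr//; last 2 first.
- exact/measurable_EFinP.
- by move=> x _; rewrite lee_fin.
rewrite exprS EFinM lee_pmul//.
by apply: integral_ge0 => x _; rewrite lee_fin.
Qed.

(** Multiply by 1 - x, which is at most exp(-x): the claim becomes
1 <= (1 - x)(1 + x + 2x^2) = 1 + x^2 (1 - 2x). *)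
Lemma expR_le_quadratic (x : R) : x <= 2^-1 -> expR x <= 1 + x + 2 * x ^+ 2.
Proof.
move=> x1.
have x2 : 0 < 1 - x by lra.
have e1 : 1 - x <= (expR x)^-1 by rewrite -expRN expR_ge1Dx.
have : expR x * (1 - x) <= 1.
  rewrite -[leRHS](@divff _ (expR x)) ?gt_eqF ?expR_gt0//.
  by rewrite ler_wpM2l// expR_ge0.
move=> ex; rewrite -(ler_pM2r x2); apply: (le_trans ex).
have : 0 <= x ^+ 2 * (1 - 2 * x) by rewrite mulr_ge0 ?sqr_ge0//; lra.
lra.
Qed.

(** In the quadratic bound for the exponential the linear term integrates to
something nonpositive, which leaves 1 + 2(sM)^2 <= exp(2(sM)^2). *)
Lemma expectation_expR_le F X (M s : R) : measurable_fun setT X ->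
  (forall x, `|X x| <= M) -> (\int[F]_x (X x)%:E <= 0)%E ->
  0 <= s -> s * M <= 2^-1 ->
  (\int[F]_x (expR (s * X x))%:E <= (expR (2 * (s * M) ^+ 2))%:E)%E.
Proof.
move=> mX XM EX s0 sM.
have XI : F.-integrable setT (EFin \o X).
  apply: measurable_bounded_integrable => //.
    by rewrite (le_lt_trans (probability_le1 _ _))// ltry.
  exists M; split; first exact: num_real.
  by move=> y My x _ /=; rewrite (le_trans (XM x))// ltW.
pose c := 1 + 2 * (s * M) ^+ 2.
have cI : F.-integrable setT (EFin \o cst c).
  by apply: finite_measure_integrable_cst.
have sXI : F.-integrable setT (fun x => s%:E * (X x)%:E)%E.
  exact: integrableZl.
have EI : F.-integrable setT (EFin \o (fun x => expR (s * X x))).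
  apply: measurable_bounded_integrable => //.
    by rewrite (le_lt_trans (probability_le1 _ _))// ltry.
    by apply: measurableT_comp => //; exact: measurable_funM.
  exists (expR (s * M)); split; first exact: num_real.
  move=> y My x _ /=; rewrite ger0_norm ?expR_ge0// ltW// (le_lt_trans _ My)//.
  by rewrite ler_expR ler_wpM2l// (le_trans (ler_norm _)).
apply: (@le_trans _ _ (\int[F]_x (c%:E + s%:E * (X x)%:E))%E).
  apply: le_integral => //; first exact: integrableD.
  move=> x _ /=; rewrite -EFinM -EFinD lee_fin.
  have sXM : `|s * X x| <= s * M by rewrite normrM ger0_norm// ler_wpM2l.
  rewrite (le_trans (expR_le_quadratic _))//.
    by rewrite (le_trans (ler_norm _))// (le_trans sXM).
  rewrite /c addrAC lerD2r lerD2l ler_pM2l//.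
  rewrite -(real_normK (num_real (s * X x))).
  by rewrite ler_sqr ?nnegrE// (le_trans _ sXM).
rewrite integralD//= integral_cst//= integralZl//.
rewrite probability_setT mule1.
rewrite (@le_trans _ _ c%:E)//.
  by rewrite geeDl// mule_ge0_le0// lee_fin.
by rewrite lee_fin /c expR_ge1Dx.
Qed.

(** Chernoff bound; the constant 8 is not the sharp one of Hoeffding's
inequality, but only the exponential rate matters here.  The condition
t <= 2M is what keeps the exponents s X in the range of the quadratic bound. *)
Lemma sample_law_deviation_le F n X (M t : R) : measurable_fun setT X ->
  (forall x, `|X x| <= M) -> (\int[F]_x (X x)%:E <= 0)%E ->
  0 < t -> t <= 2 * M ->
  (sample_law F n [set z | (n%:R * t <= \sum_(i < n) X (tnth z i))%R] <=
   (expR (- (n%:R * (t ^+ 2 / (8 * M ^+ 2)))))%:E)%E.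
Proof.
move=> mX XM EX t0 tM.
have M0 : 0 < M by lra.
(* This s minimizes - s t + 2 (s M)^2, the exponent per observation. *)
pose s := t / (4 * M ^+ 2).
have s0 : 0 < s by rewrite divr_gt0// mulr_gt0// exprn_gt0.
have sM : s * M <= 2^-1.
  rewrite /s (_ : _ * M = t / (4 * M)); last by field; rewrite gt_eqF.
  by rewrite ler_pdivrMr; lra.
pose S (z : n.-tuple T) := \sum_(i < n) X (tnth z i).
have mS : measurable_fun setT S by exact: measurable_fun_sum_tnth.
pose mfS := isMeasurableFun.Build _ _ _ _ S mS.
pose Y : {RV sample_law F n >-> R} := HB.pack S mfS.
apply: (le_trans (chernoff Y (n%:R * t) s0)).
rewrite /mmt_gen_fun unlock/=.
under eq_integral => z _.
  rewrite /S mulrC big_distrr/= expR_sum.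
  over.
have mE : measurable_fun setT (fun x => expR (s * X x)).
  by apply: measurableT_comp => //; exact: measurable_funM.
have := integral_sample_law_prod_le n mE
  (fun x => expR_ge0 _) (expectation_expR_le mX XM EX (ltW s0) sM).
set J := (\int[_]_z _)%E => HJ.
apply: (@le_trans _ _
    ((expR (2 * (s * M) ^+ 2) ^+ n)%:E * (expR (- (s * (n%:R * t))))%:E)%E).
  by rewrite lee_pmul2r// lte_fin expR_gt0.
rewrite -EFinM lee_fin -expRM_natl -expRD ler_expR le_eqVlt; apply/orP; left.
by apply/eqP; rewrite /s; field; rewrite gt_eqF.
Qed.

End deviation.

(** * Empirical risk minimization over a finite list *)

Section argmin_on.
Variables (R : realType) (V : eqType).
Implicit Types (b : V) (s : seq V) (f : V -> R).

(** The default b0 is a candidate too, so the minimum is over b0 :: s. *)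
Fixpoint argmin_on b0 s f : V :=
  if s is b :: s' then
    let b' := argmin_on b0 s' f in if f b <= f b' then b else b'
  else b0.

Lemma argmin_on_mem b0 s f : argmin_on b0 s f \in b0 :: s.
Proof.
elim: s => [|b s IH] /=; first by rewrite mem_head.
case: ifP => _; first by rewrite !inE eqxx orbT.
by move: IH; rewrite !inE => /orP[->//|->]; rewrite !orbT.
Qed.

Lemma argmin_on_le b0 s f b : b \in b0 :: s -> f (argmin_on b0 s f) <= f b.
Proof.
elim: s b => [|c s IH] b /=; first by rewrite inE => /eqP->.
have {}IH := IH; rewrite !inE => H.
have [cs|/ltW sc] := leP (f c).
  move: H => /or3P[/eqP->|/eqP->//|bs]; rewrite (le_trans cs) ?IH ?inE ?eqxx//.
  by rewrite bs orbT.
move: H => /or3P[/eqP->|/eqP->//|bs]; rewrite ?IH ?inE ?eqxx ?bs ?orbT//.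
Qed.

(** The selected element depends on z, so measurability is proved for an
arbitrary family G evaluated at the selected element: the induction uses it
both for G and for Phi, whose minimal value is compared with the next
candidate. *)
Lemma measurable_argmin_on d d' (U : measurableType d) (W : measurableType d')
    b0 s (Phi : V -> U -> R) (G : V -> U -> W) :
  (forall b, b \in b0 :: s -> measurable_fun setT (Phi b)) ->
  (forall b, b \in b0 :: s -> measurable_fun setT (G b)) ->
  measurable_fun setT (fun z => G (argmin_on b0 s (Phi ^~ z)) z).
Proof.
elim: s d' W G => [|b s IH] d' W G mPhi mG /=; first exact/mG/mem_head.
have sub c : c \in b0 :: s -> c \in b0 :: b :: s.
  by rewrite !inE => /orP[->//|->]; rewrite !orbT.
have bs : b \in b0 :: b :: s by rewrite !inE eqxx orbT.
rewrite [X in measurable_fun _ X](_ : _ = fun z =>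
    if Phi b z <= Phi (argmin_on b0 s (Phi ^~ z)) z
    then G b z else G (argmin_on b0 s (Phi ^~ z)) z); last first.
  by apply/funext => z; case: ifP.
apply: measurable_fun_ifT.
- apply: measurable_fun_ler; first exact: mPhi.
  by apply: IH => c /sub; [exact: mPhi|exact: mPhi].
- exact: mG.
- by apply: IH => c /sub; [exact: mPhi|exact: mG].
Qed.

End argmin_on.

Lemma measure_seq_union_le d (T : measurableType d) (R : realType)
    (P : probability T R) (I : eqType) (s : seq I) (E : I -> set T) (a : R) :
  (forall i, i \in s -> measurable (E i)) ->
  (forall i, i \in s -> (P (E i) <= a%:E)%E) ->
  (P (\big[setU/set0]_(i <- s) E i) <= ((size s)%:R * a)%:E)%E.
Proof.
elim: s => [|i s IH] mE PE; first by rewrite big_nil measure0 mul0r.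
have sub j : j \in s -> j \in i :: s by rewrite inE orbC => ->.
rewrite big_cons /= -natr1 mulrDl mul1r addrC EFinD.
have mEi : measurable (E i) by exact/mE/mem_head.
have mEs : measurable (\big[setU/set0]_(j <- s) E j).
  by rewrite big_seq; apply: bigsetU_measurable => j /sub; exact: mE.
apply: (le_trans (measureU2 P mEi mEs)).
apply: leeD; first exact/PE/mem_head.
by apply: IH => j /sub; [exact: mE|exact: PE].
Qed.

Section empirical_risk_minimization.
Context d (T : measurableType d) (R : realType) (V : choiceType).

(** The sum over the sample, which has the same minimizers as the mean. *)
Definition empirical_risk n (f : V -> T -> R) (b : V) (z : n.-tuple T) : R :=
  \sum_(i < n) f b (tnth z i).

Definition erm n (f : V -> T -> R) b0 s (z : n.-tuple T) : V :=
  argmin_on b0 s (fun b => empirical_risk f b z).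

Lemma measurable_erm d' (W : measurableType d') n (f : V -> T -> R) b0 s
    (G : V -> W) : (forall b, b \in b0 :: s -> measurable_fun setT (f b)) ->
  measurable_fun setT (fun z : n.-tuple T => G (erm f b0 s z)).
Proof.
move=> mf; apply: (measurable_argmin_on (G := fun b _ => G b)) => b bs.
  by apply: measurable_fun_sum_tnth; exact: mf.
exact: measurable_cst.
Qed.

(** As erm takes finitely many values, every predicate of its value gives a
measurable event. *)
Lemma measurable_erm_event n (f : V -> T -> R) b0 s (bad : V -> Prop) :
  (forall b, b \in b0 :: s -> measurable_fun setT (f b)) ->
  measurable [set z : n.-tuple T | bad (erm f b0 s z)].
Proof.
move=> mf.
have /(_ measurableT [set true] I) :=
  measurable_erm (n := n) (fun b => `[< bad b >]) mf.
by rewrite setTI; congr measurable; apply/seteqP; split => z /= /asboolP.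
Qed.

(** A bad entry, whose mean exceeds that of b1 by 2t, is selected only if its
empirical mean falls t below its expectation or that of b1 rises t above: this
is a union of size (b0 :: s) + 1 one-sided deviation events. *)
Lemma erm_bad_le (F : probability T R) n (f : V -> T -> R) b0 s b1 (M l t : R)
    (bad : V -> Prop) :
  (forall b, b \in b0 :: s -> measurable_fun setT (f b)) ->
  (forall b x, b \in b0 :: s -> 0 <= f b x <= M) ->
  0 < t -> t <= 2 * M -> b1 \in b0 :: s ->
  (\int[F]_x (f b1 x)%:E <= l%:E)%E ->
  (forall b, b \in b0 :: s -> bad b ->
     ((l + 2 * t)%:E <= \int[F]_x (f b x)%:E)%E) ->
  (sample_law F n [set z | bad (erm f b0 s z)] <=
   ((size s).+2%:R * expR (- (n%:R * (t ^+ 2 / (8 * M ^+ 2)))))%:E)%E.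
Proof.
move=> mf fM t0 tM b1s fb1 fbad.
set e := expR _.
have fI b : b \in b0 :: s -> F.-integrable setT (EFin \o f b).
  move=> bs; apply: measurable_bounded_integrable => //; last 2 first.
  - exact: mf.
  - exists M; split; first exact: num_real.
    move=> y My x _ /=; have /andP[f0 fM1] := fM b x bs.
    by rewrite ger0_norm// (le_trans fM1)// ltW.
  by rewrite (le_lt_trans (probability_le1 _ _))// ltry.
pose mu b := fine (\int[F]_x (f b x)%:E)%E.
have muE b : b \in b0 :: s -> (\int[F]_x (f b x)%:E)%E = (mu b)%:E.
  by move=> bs; rewrite fineK//; apply: integrable_fin_num => //; exact: fI.
have mu0M b : b \in b0 :: s -> 0 <= mu b <= M.
  move=> bs; rewrite -!lee_fin -muE//; apply/andP; split.
    by apply: integral_ge0 => x _; rewrite lee_fin; case/andP: (fM b x bs).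
  have -> : M%:E = (\int[F]_x (cst M%:E x))%E.
    by rewrite integral_cst//= probability_setT mule1.
  apply: le_integral => //; first exact: fI.
    exact: finite_measure_integrable_cst.
  by move=> x _; rewrite lee_fin; case/andP: (fM b x bs).
have dev b x : b \in b0 :: s -> `|f b x - mu b| <= M.
  move=> bs; have := mu0M b bs; have := fM b x bs; rewrite ler_norml.
  by move=> /andP[? ?] /andP[? ?]; apply/andP; split; lra.
have Edev b : b \in b0 :: s -> (\int[F]_x (f b x - mu b)%:E = 0)%E.
  move=> bs; under eq_integral do rewrite EFinB.
  rewrite integralB//; [|exact: fI|exact: finite_measure_integrable_cst].
  by rewrite muE// integral_cst//= probability_setT mule1 subee.
have Edev' b : b \in b0 :: s -> (\int[F]_x (mu b - f b x)%:E = 0)%E.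
  move=> bs; under eq_integral do rewrite EFinB.
  rewrite integralB//; [|exact: finite_measure_integrable_cst|exact: fI].
  by rewrite muE// integral_cst//= probability_setT mule1 subee.
pose up := [set z : n.-tuple T |
  n%:R * t <= \sum_(i < n) (f b1 (tnth z i) - mu b1)].
pose down b := [set z : n.-tuple T |
  n%:R * t <= \sum_(i < n) (mu b - f b (tnth z i))].
have mge (X : T -> R) : measurable_fun setT X ->
    measurable [set z : n.-tuple T | n%:R * t <= \sum_(i < n) X (tnth z i)].
  move=> mX; rewrite -[X in measurable X]setTI.
  by apply: measurable_fun_le => //; exact: measurable_fun_sum_tnth.
have mup : measurable up.
  apply: (mge (fun x => f b1 x - mu b1)).
  by apply: measurable_funB => //; exact: mf.
have mdown b : b \in b0 :: s -> measurable (down b).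
  move=> bs; apply: (mge (fun x => mu b - f b x)).
  by apply: measurable_funB => //; exact: mf.
have Pup : (sample_law F n up <= e%:E)%E.
  apply: (@sample_law_deviation_le _ _ _ _ _ (fun x => f b1 x - mu b1)) => //.
  - by apply: measurable_funB => //; exact: mf.
  - by move=> x; exact: dev.
  - by rewrite Edev.
have Pdown b : b \in b0 :: s -> (sample_law F n (down b) <= e%:E)%E.
  move=> bs.
  apply: (@sample_law_deviation_le _ _ _ _ _ (fun x => mu b - f b x)) => //.
  - by apply: measurable_funB => //; exact: mf.
  - by move=> x; rewrite distrC; exact: dev.
  - by rewrite Edev'.
have sub : [set z | bad (erm f b0 s z)] `<=`
    up `|` \big[setU/set0]_(b <- b0 :: s) down b.
  move=> z /= badz; have [zup|zup] := pselect (up z); [by left|right].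
  set b := erm f b0 s z in badz.
  have bs : b \in b0 :: s by exact: argmin_on_mem.
  rewrite -bigcup_seq; exists b => //=; rewrite /down/=.
  have : empirical_risk f b z <= empirical_risk f b1 z.
    exact: (argmin_on_le (empirical_risk f ^~ z) b1s).
  move: zup => /negP; rewrite /up/= -ltNge !sumrB !sumr_const !card_ord.
  rewrite -[mu b1 *+ n]mulr_natl -[mu b *+ n]mulr_natl.
  rewrite -/(empirical_risk f b z) -/(empirical_risk f b1 z) => h1 h2.
  have h3 : n%:R * mu b1 <= n%:R * l :> R.
    by rewrite ler_wpM2l// -lee_fin -muE.
  have h4 : n%:R * (l + 2 * t) <= n%:R * mu b :> R.
    by rewrite ler_wpM2l// -lee_fin -muE// fbad.
  lra.
have mdowns : measurable (\big[setU/set0]_(b <- b0 :: s) down b).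
  by rewrite big_seq; apply: bigsetU_measurable => b; exact: mdown.
apply: (@le_trans _ _
    (sample_law F n (up `|` \big[setU/set0]_(b <- b0 :: s) down b))).
  apply: le_measure => //; rewrite ?inE; last exact: measurableU.
  exact: measurable_erm_event.
apply: (le_trans (measureU2 _ mup mdowns)).
rewrite -natr1 mulrDl mul1r addrC EFinD leeD//.
exact: measure_seq_union_le.
Qed.

End empirical_risk_minimization.

(** * A finite net for the sparse predictors in coordinate cubes *)

Section sparse_net.
Variable R : realType.

(** A code lists at most k coordinates, each with the index of an interval of
length h, counted from - r; the other coordinates are 0.  Using functions on
'I_k instead of pairs (S, cell) makes the number of codes immediate; a code
that puts one coordinate in two different intervals just has an empty cell. *)
Definition grid_cell m k q (r h : R) (c : {ffun 'I_k -> 'I_m * 'I_q}) :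
    set 'rV[R]_m :=
  [set b | (forall i, (c i).2%:R * h <= b 0 (c i).1 + r < (c i).2.+1%:R * h) /\
           (forall j, j \notin [set (c i).1 | i : 'I_k]%SET -> b 0 j = 0)].

Lemma grid_cell_l2norm m k q (r h : R) (c : {ffun 'I_k -> 'I_m * 'I_q}) b b' :
  (0 < k)%N -> 0 < h -> grid_cell r h c b -> grid_cell r h c b' ->
  l2norm (b - b') <= k%:R * h.
Proof.
move=> k0 h0 [bc b0] [b'c b'0].
set A := [set (c i).1 | i : 'I_k]%SET in b0 b'0.
have kh : 0 <= k%:R * h by rewrite mulr_ge0// ltW.
rewrite -(ger0_norm kh) -sqrtr_sqr ler_wsqrtr//.
rewrite (bigID (mem A))/= [X in _ + X]big1 ?addr0; last first.
  by move=> j jA; rewrite !mxE b0// b'0// subr0 expr0n.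
have cA : (#|A| <= k)%N by rewrite (leq_trans (leq_imset_card _ _))// card_ord.
apply: (@le_trans _ _ (\sum_(j in A) h ^+ 2)).
  apply: ler_sum => j /imsetP[i _ ->]; rewrite !mxE.
  have /andP[b1 b2] := bc i; have /andP[b3 b4] := b'c i.
  rewrite -!natr1 !mulrDl !mul1r in b2 b4.
  rewrite -(real_normK (num_real (_ - _))) ler_sqr ?nnegrE ?(ltW h0)//.
  by rewrite ler_norml; apply/andP; split; lra.
rewrite sumr_const exprMn -[leLHS]mulr_natl ler_wpM2r ?sqr_ge0//.
by rewrite -natrX ler_nat (leq_trans cA)// -[leqLHS]expn1 leq_pexp2l.
Qed.

Lemma cube_grid_cell m k (r h : R) (S : {set 'I_m}) b :
  #|S| = k -> 0 < h -> cube 0 S r b ->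
  exists c : {ffun 'I_k -> 'I_m * 'I_(Num.truncn (2 * r / h)).+1},
    grid_cell r h c b.
Proof.
move=> Sk; case: _ / Sk => h0 [v vS <-].
have vr j : j \in S -> 0 <= v 0 j + r <= 2 * r.
  by move=> /(vS j).2; rewrite ler_norml => /andP[? ?]; apply/andP; split; lra.
exists [ffun i => (enum_val i, inord (Num.truncn ((v 0 (enum_val i) + r) / h)))].
split => [i|j jS]; rewrite add0r.
  rewrite ffunE/=.
  have /vr/andP[v0 v2] := enum_valP i.
  rewrite inordK; last first.
    by rewrite ltnS; apply: le_truncn; rewrite ler_pM2r ?invr_gt0.
  by rewrite -ler_pdivlMr// -ltr_pdivrMr// truncn_itv// divr_ge0// ltW.
apply: (vS j).1; apply: contra jS => jS; apply/imsetP.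
by exists (enum_rank_in jS j); rewrite // ffunE/= enum_rankK_in.
Qed.

Definition cube_net_size m k (r h : R) : nat :=
  ((m * (Num.truncn (2 * r / h)).+1) ^ k)%N.

(** The net consists of one point of A from each nonempty cell, so its points
stay in A, which need not contain the centres of the cells. *)
Lemma sparse_cube_net m k (r h : R) (A : set 'rV[R]_m) : (0 < k)%N -> 0 < h ->
  exists s : seq 'rV[R]_m, [/\ {in s, forall b, A b},
    (size s <= cube_net_size m k r h)%N &
    forall (S : {set 'I_m}) b, A b -> #|S| = k -> cube 0 S r b ->
      exists2 b', b' \in s & l2norm (b - b') <= k%:R * h].
Proof.
move=> k0 h0; rewrite /cube_net_size; set q := (Num.truncn _).+1.
pose code := {ffun 'I_k -> 'I_m * 'I_q}.
pose rep (c : code) : option 'rV[R]_m :=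
  if pselect (exists b, A b /\ grid_cell r h c b) is left ex
  then Some (projT1 (cid ex)) else None.
exists (pmap rep (enum code)); split.
- move=> b; rewrite mem_pmap => /mapP[c _]; rewrite /rep.
  by case: pselect => //= ex [->]; case: (cid ex) => b' [].
- rewrite size_pmap (leq_trans (count_size _ _))// -cardE card_ffun.
  by rewrite card_prod !card_ord.
- move=> S b Ab Sk bS; have [c bc] := cube_grid_cell Sk h0 bS.
  have ex : exists b, A b /\ grid_cell r h c b by exists b.
  have [b' cb' Hb'] : exists2 b', rep c = Some b' & grid_cell r h c b'.
    rewrite /rep; case: pselect => // ex'.
    by exists (projT1 (cid ex')) => //; case: (cid ex') => b' [].
  exists b'; last exact: grid_cell_l2norm bc Hb'.
  by rewrite mem_pmap -cb' map_f// mem_enum.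
Qed.

Lemma cube_sparse m (S : {set 'I_m}) (r : R) b : cube 0 S r b ->
  (#|[pred j | (b 0 j != 0)%R]| <= #|S|)%N.
Proof.
move=> [v vS <-]; apply: subset_leq_card; apply/fintype.subsetP => j.
by rewrite inE add0r; apply: contraNT => /(vS j).1 ->.
Qed.

End sparse_net.

(** * The procedure at a fixed sample size *)

Section erm_over_net.
Variables (R : realType) (m : nat).
Implicit Types (lb : 'rV[R]_m -> obs R m -> R) (B : set 'rV[R]_m).
Implicit Types (F : probability (obs R m) R) (b : 'rV[R]_m).

Lemma risk_ge0 lb F b : (forall b z, 0 <= lb b z) -> (0 <= risk lb F b)%E.
Proof. by move=> lb0; apply: expectation_ge0. Qed.

Lemma trunc_risk_le lb (M M' : R) F b : (forall b z, 0 <= lb b z) ->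
  measurable_fun setT (lb b) -> 0 <= M' -> M <= M' ->
  (trunc_risk lb M F b <= trunc_risk lb M' F b)%E.
Proof.
move=> lb0 mlb M'0 MM'; rewrite /trunc_risk unlock.
have I (c : R) : F.-integrable setT (fun z => (Num.min (lb b z) c)%:E).
  apply: measurable_bounded_integrable => //; last 2 first.
  - exact: measurable_minr.
  - exists `|c|; split; first exact: num_real.
    move=> y My z _ /=; rewrite (le_trans _ (ltW My))// ler_norml.
    rewrite ge_min ler_norm orbT andbT le_min.
    rewrite (le_trans _ (lb0 b z)) ?oppr_le0//=.
    by rewrite lerNl -normrN ler_norm.
  by rewrite (le_lt_trans (probability_le1 _ _))// ltry.
apply: le_integral => //.
by move=> z _; rewrite lee_fin le_min !ge_min lexx MM' orbT.
Qed.

Lemma trunc_risk_le_risk lb (M : R) F b : (forall b z, 0 <= lb b z) ->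
  measurable_fun setT (lb b) -> 0 <= M ->
  (trunc_risk lb M F b <= risk lb F b)%E.
Proof.
move=> lb0 mlb M0; rewrite /trunc_risk /risk unlock.
apply: ge0_le_integral => //.
- by move=> z _; rewrite lee_fin le_min lb0.
- by apply/measurable_EFinP; exact: measurable_minr.
- by apply/measurable_EFinP.
- by move=> z _; rewrite lee_fin ge_min lexx.
Qed.

Lemma ereal_close_EFin_le (e x : R) (y : \bar R) :
  0 <= e -> ereal_close e x%:E y -> (y <= (x + e)%:E)%E.
Proof.
move=> e0 [<-|]; first by rewrite lee_fin lerDl.
case: y => [y| |] /=; rewrite ?leNye// lte_fin lee_fin.
by rewrite distrC => /ltW; rewrite ler_norml => /andP[_]; lra.
Qed.

(** Here eta is the distance at which hypothesis (ii) makes risks e/8-close;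
the mesh eta / (2k) keeps the diameter of a cell, at most k times the mesh,
strictly below it.  The side 2r of the cube is determined by its volume, hence
common to all F: this is why one net serves every F.  Measurability of the
excess events is asserted at every level e', as needed when procedures built
for different e are combined. *)
Lemma erm_over_net (n k : nat) (FF : set (probability (obs R m) R)) B lb
    (bstar : probability (obs R m) R -> 'rV[R]_m) (vol eta e M : R) :
  FF !=set0 -> (forall b z, 0 <= lb b z) ->
  (forall b, B b -> measurable_fun setT (lb b)) ->
  (forall F, FF F -> is_argmin B (risk lb F) (bstar F)) ->
  (0 < k)%N ->
  (forall F, FF F -> exists2 C, is_cube k 0 vol C & C (bstar F)) ->
  0 < eta -> 0 < e -> e <= M ->
  (forall F b b', FF F -> sparse B k b -> sparse B k b' ->
     l2norm (b - b') < eta ->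
     ereal_close (e / 8) (risk lb F b) (risk lb F b')) ->
  exists bhat : n.-tuple (obs R m) -> 'rV[R]_m,
    [/\ is_procedure B bhat,
      forall F e', FF F ->
        measurable (excess_event (risk lb F) (bstar F) e' bhat) &
      exists r, [/\ 0 < r, (2 * r) ^+ k = vol &
        forall F, FF F ->
          (forall b, B b -> (risk lb F b > risk lb F (bstar F) + e%:E)%E ->
            (trunc_risk lb M F b > risk lb F (bstar F) + (e / 2)%:E)%E) ->
          (sample_law F n (excess_event (risk lb F) (bstar F) e bhat) <=
           ((cube_net_size m k r (eta / (2 * k%:R))).+1%:R *
            expR (- (n%:R * ((e / 8) ^+ 2 / (8 * M ^+ 2)))))%:E)%E]].
Proof.
move=> [F0 FF0] lb0 mlb Bstar k0 cubeP eta0 e0 eM close.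
have kR0 : 0 < k%:R :> R by rewrite ltr0n.
have M0 : 0 < M by exact: lt_le_trans eM.
have [_ [S0 [r [S0k r0 -> volE]]] bS0] := cubeP F0 FF0.
have starP F : FF F -> sparse B k (bstar F) /\
    exists2 S : {set 'I_m}, #|S| = k & cube 0 S r (bstar F).
  move=> FFF; have [_ [S [r' [Sk r'0 -> volE']]] bS] := cubeP F FFF.
  have rr' : r' = r.
    have /eqP := etrans volE' (esym volE).
    rewrite eqrXn2 ?mulr_ge0 ?ltW// => /eqP.
    by apply: mulfI; rewrite pnatr_eq0.
  rewrite rr' in bS; split; last by exists S.
  by split; [have [] := Bstar F FFF|rewrite -Sk; exact: cube_sparse bS].
set h := eta / (2 * k%:R).
have h0 : 0 < h by rewrite divr_gt0// mulr_gt0.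
have [s [sB sz snet]] := sparse_cube_net r (sparse B k) k0 h0.
have near_star F : FF F ->
    exists2 b, b \in s & ereal_close (e / 8) (risk lb F (bstar F)) (risk lb F b).
  move=> FFF; have [Bs [S Sk bS]] := starP F FFF.
  have [b bs lb_h] := snet S _ Bs Sk bS; exists b => //.
  apply: close => //; first exact: sB.
  rewrite (le_lt_trans lb_h)// /h (_ : _ * _ = eta / 2); first lra.
  by field; rewrite gt_eqF.
have [b0 [s' sE]] : exists b0 s', s = b0 :: s'.
  by have [b] := near_star F0 FF0; case: (s) => // b0 s' _ _; exists b0, s'.
pose f b z := Num.min (lb b z) M.
have mf b : b \in b0 :: s' -> measurable_fun setT (f b).
  rewrite -sE => /sB[Bb _]; apply: measurable_minr => //; exact: mlb.
exists (erm f b0 s'); split.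
- split => [z|j]; last exact: (measurable_erm (fun b => b 0 j)).
  by have /sB[] : erm f b0 s' z \in s by rewrite sE argmin_on_mem.
- move=> F e' _.
  exact: (measurable_erm_event
    (fun b => (risk lb F b - risk lb F (bstar F) > e'%:E)%E)).
exists r; split => // F FFF sep.
have [b1 b1s close1] := near_star F FFF.
(* If the best risk is infinite so are all risks, and oo - oo = - oo is not
   above e. *)
have : (0 <= risk lb F (bstar F))%E by exact: risk_ge0.
case LE : (risk lb F (bstar F)) => [x| |]// _; last first.
  rewrite [X in sample_law F n X](_ : _ = set0).
    by rewrite measure0 lee_fin mulr_ge0 ?expR_ge0.
  apply/seteqP; split => z //=; rewrite /excess_event/= LE.
  by case: (risk lb F _).
rewrite LE in close1 sep.
have e8 : 0 < e / 8 by rewrite divr_gt0.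
have l1 : (risk lb F b1 <= (x + e / 8)%:E)%E.
  by apply: ereal_close_EFin_le close1; exact: ltW.
have lbs b : b \in b0 :: s' -> measurable_fun setT (lb b).
  by rewrite -sE => /sB[Bb _]; exact: mlb.
have := @erm_bad_le _ _ _ _ F n f b0 s' b1 M (x + e / 8) (e / 8)
  (fun b => (risk lb F b - risk lb F (bstar F) > e%:E)%E) mf.
rewrite /excess_event => /(_ _ _ _ _ _ _)/le_trans; apply => //.
- move=> b z bs; rewrite /f le_min lb0 ltW//= ge_min lexx orbT//.
- lra.
- by rewrite -sE.
- apply: le_trans l1; have := @trunc_risk_le_risk lb M F b1 lb0.
  by rewrite /trunc_risk unlock; apply; [apply: lbs; rewrite -sE|exact: ltW].
- move=> b bs; rewrite LE => badb.
  have [Bb _] : sparse B k b by apply: sB; rewrite sE.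
  have /(sep b Bb) : (x%:E + e%:E < risk lb F b)%E by rewrite addeC -lteBrDr.
  rewrite /trunc_risk unlock => /ltW; apply: le_trans.
  by rewrite -EFinD lee_fin; lra.
- rewrite lee_fin ler_wpM2r ?expR_ge0// ler_nat ltnS.
  by move: sz; rewrite sE.
Qed.

End erm_over_net.

(** * The logarithm of the size of the net is o(n) *)

Section net_cardinality.
Variable R : realType.

Lemma exprD1_le (a : R) k : 0 <= a -> (1 + a) ^+ k <= 2 ^+ k * (1 + a ^+ k).
Proof.
move=> a0; have ak0 : 0 <= a ^+ k by exact: exprn_ge0.
have [a1|/ltW a1] := leP a 1.
  apply: (@le_trans _ _ (2 ^+ k)); last by rewrite ler_peMr ?exprn_ge0// lerDl.
  by apply: lerXn2r; rewrite ?nnegrE//; lra.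
apply: (@le_trans _ _ ((2 * a) ^+ k)).
  by apply: lerXn2r; rewrite ?nnegrE//; lra.
by rewrite exprMn ler_wpM2l ?exprn_ge0// lerDr.
Qed.

(** With h the mesh, 2r/h + 1 <= (1 + 2r)(1 + 1/h); the first factor
contributes at most 2^k (1 + vol) to the k-th power, and 1/h is polynomial in n
because k <= n. *)
Lemma net_card_le (alpha gamma delta r : R) (n k : nat) :
  (0 < n)%N -> (0 < k <= n)%N -> 0 < gamma -> 0 < delta -> 0 < r ->
  (cube_net_size (array_dim alpha n) k r
    (delta * n%:R `^ (- gamma) / (2 * k%:R)))%:R
  <= (2 * (1 + 2 / delta) * n%:R `^ (alpha + gamma + 1)) ^+ k
     * (1 + (2 * r) ^+ k) :> R.
Proof.
move=> n0 /andP[k0 kn] g0 d0 r0.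
have nR0 : 0 < n%:R :> R by rewrite ltr0n.
have kR0 : 0 < k%:R :> R by rewrite ltr0n.
have kR : k%:R <= n%:R :> R by rewrite ler_nat.
have n1 : 1 <= n%:R :> R by rewrite ler1n.
have ng0 : 0 < n%:R `^ gamma :> R by exact: powR_gt0.
have ng1 : 1 <= n%:R `^ gamma :> R.
  by rewrite -[leLHS](powRr0 n%:R) ler_powR// ltW.
rewrite powRN /cube_net_size.
set h := _ / (2 * k%:R).
have hV : h^-1 = 2 / delta * (k%:R * n%:R `^ gamma).
  by rewrite /h; field; rewrite !gt_eqF.
have h0 : 0 < h^-1 by rewrite hV !mulr_gt0 ?invr_gt0.
rewrite natrX natrM.
have mle : (array_dim alpha n)%:R <= n%:R `^ alpha :> R.
  by rewrite truncn_le// powR_ge0.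
have qle : (Num.truncn (2 * r / h)).+1%:R <=
    (1 + 2 * r) * ((1 + 2 / delta) * (n%:R * n%:R `^ gamma)) :> R.
  rewrite -natr1.
  have : (Num.truncn (2 * r / h))%:R <= 2 * r / h :> R.
    by rewrite truncn_le// mulr_ge0 ?ltW ?mulr_gt0.
  have h1 : h^-1 <= 2 / delta * (n%:R * n%:R `^ gamma).
    rewrite hV; apply: ler_wpM2l; first by rewrite divr_ge0// ltW.
    by apply: ler_wpM2r => //; exact: ltW.
  have h2 : 1 <= n%:R * n%:R `^ gamma :> R by rewrite mulr_ege1.
  have h3 : 1 + h^-1 <= (1 + 2 / delta) * (n%:R * n%:R `^ gamma) by lra.
  have h4 : (1 + 2 * r) * (1 + h^-1) <=
      (1 + 2 * r) * ((1 + 2 / delta) * (n%:R * n%:R `^ gamma)).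
    by rewrite ler_wpM2l//; lra.
  lra.
have C0 : 0 < 1 + 2 / delta by rewrite addr_gt0// divr_gt0.
apply: (@le_trans _ _ ((n%:R `^ (alpha + gamma + 1) * (1 + 2 / delta)
    * (1 + 2 * r)) ^+ k)).
  apply: lerXn2r; rewrite ?nnegrE.
  - by rewrite mulr_ge0.
  - by rewrite !mulr_ge0 ?powR_ge0//; lra.
  apply: (le_trans (ler_pM _ _ mle qle)) => //.
  have pD x y : n%:R `^ (x + y) = n%:R `^ x * n%:R `^ y :> R.
    by rewrite powRD// (gt_eqF nR0) implybT.
  rewrite !pD powRr1//.
  rewrite le_eqVlt; apply/orP; left; apply/eqP; ring.
rewrite exprMn.
apply: (@le_trans _ _ ((n%:R `^ (alpha + gamma + 1) * (1 + 2 / delta)) ^+ k *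
    (2 ^+ k * (1 + (2 * r) ^+ k)))).
  apply: ler_wpM2l; first by rewrite exprn_ge0// mulr_ge0 ?powR_ge0// ltW.
  by apply: exprD1_le; rewrite mulr_ge0// ltW.
rewrite mulrA -exprMn.
rewrite (_ : _ * 2 = 2 * (1 + 2 / delta) * n%:R `^ (alpha + gamma + 1))//.
ring.
Qed.

Lemma near_ln_ge1 : \forall n \near \oo, 1 <= ln (n%:R : R).
Proof.
near=> n.
have e0 : 0 < expR 1 :> R by exact: expR_gt0.
have en : expR 1 <= n%:R :> R by near: n; exact: nbhs_infty_ger.
by rewrite -[leLHS]expRK ler_ln ?posrE// (lt_le_trans e0).
Unshelve. all: by end_near. Qed.

(** In the bound of net_card_le the power is exp(k_n O(log n)), and
k_n log n = o(n); each of the two factors is thus eventually at most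
exp(c n / 2), up to the summand 1 next to the volume. *)
Lemma net_card_subexponential (alpha gamma delta c : R) (k : nat -> nat)
    (vol : nat -> R) :
  0 < gamma -> 0 < delta -> 0 < c ->
  (forall n, (0 < n)%N -> (0 < k n)%N) ->
  (fun n => (k n)%:R : R^o) =o_\oo (fun n => n%:R / ln n%:R : R^o) ->
  (forall n, (0 < n)%N -> 0 < vol n) ->
  (fun n => ln (vol n) : R^o) =o_\oo (fun n => n%:R : R^o) ->
  \forall n \near \oo, forall r, 0 < r -> (2 * r) ^+ k n = vol n ->
  (cube_net_size (array_dim alpha n) (k n) r
    (delta * n%:R `^ (- gamma) / (2 * (k n)%:R))).+1%:R
  <= 3 * expR (c * n%:R) :> R.
Proof.
move=> g0 d0 c0 k0 ko v0 vo.
pose C : R := 2 * (1 + 2 / delta).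
have C1 : 1 <= C by rewrite /C; have : 0 < 2 / delta by [rewrite divr_gt0]; lra.
have C0 : 0 < C by lra.
pose D := ln C + `|alpha + gamma + 1| + 1.
have D0 : 0 < D.
  by rewrite /D; have := ln_ge0 C1; have := normr_ge0 (alpha + gamma + 1); lra.
have c20 : 0 < c / 2 by rewrite divr_gt0.
move/eqoP: ko => ko; move/eqoP: vo => vo.
near=> n => r r0 rv.
have n0 : (0 < n)%N by near: n; exact: nbhs_infty_gt.
have nR0 : 0 < n%:R :> R by rewrite ltr0n.
have ln1 : 1 <= ln n%:R :> R by near: n; exact: near_ln_ge1.
have ln0 : 0 < ln n%:R :> R by lra.
have kn0 : 0 < (k n)%:R :> R by rewrite ltr0n k0.
have kle1 : (k n)%:R <= n%:R / ln n%:R :> R.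
  have : `|(k n)%:R : R^o| <= 1 * `|n%:R / ln n%:R : R^o|.
    by near: n; apply: ko.
  by rewrite mul1r !ger0_norm// ?divr_ge0// ltW.
have kle2 : (k n)%:R <= c / 2 / D * (n%:R / ln n%:R) :> R.
  have : `|(k n)%:R : R^o| <= c / 2 / D * `|n%:R / ln n%:R : R^o|.
    by near: n; apply: ko; rewrite divr_gt0.
  by rewrite !ger0_norm// ?divr_ge0// ltW.
have vle : ln (vol n) <= c / 2 * n%:R.
  have : `|ln (vol n) : R^o| <= c / 2 * `|n%:R : R^o|.
    by near: n; apply: vo.
  by rewrite [in X in _ <= X]ger0_norm//; apply: le_trans; exact: ler_norm.
have kn : (k n <= n)%N.
  rewrite -(ler_nat R) (le_trans kle1)// ler_pdivrMr//.
  by rewrite ler_peMr// ltW.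
have kbd : (0 < k n <= n)%N by rewrite k0.
have := net_card_le alpha n0 kbd g0 d0 r0; rewrite rv -/C => Nle.
set N := cube_net_size _ _ _ _ in Nle *.
have X1 : (C * n%:R `^ (alpha + gamma + 1)) ^+ k n <= expR (c / 2 * n%:R).
  have P0 : 0 < C * n%:R `^ (alpha + gamma + 1) by rewrite mulr_gt0// powR_gt0.
  rewrite -[X in X ^+ _]lnK ?posrE// -expRM_natl ler_expR lnM ?posrE ?powR_gt0//.
  rewrite ln_powR.
  have : ln C + (alpha + gamma + 1) * ln n%:R <= D * ln n%:R.
    rewrite /D; move: (alpha + gamma + 1) => a.
    rewrite !mulrDl mul1r -addrA.
    apply: lerD; first by rewrite ler_peMr ?ln_ge0.
    apply: ler_wpDr; first exact: ltW.
    by apply: ler_wpM2r; [exact: ltW|exact: ler_norm].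
  move=> /(ler_wpM2l (ltW kn0)) /le_trans; apply.
  have DL : 0 < D * ln n%:R by rewrite mulr_gt0.
  have := ler_wpM2r (ltW DL) kle2.
  rewrite (_ : c / 2 / D * _ * _ = c / 2 * n%:R)//.
  by field; rewrite !gt_eqF.
have X2 : vol n <= expR (c / 2 * n%:R).
  by rewrite -[leLHS]lnK ?posrE ?v0// ler_expR.
have cE : expR (c * n%:R) = expR (c / 2 * n%:R) * expR (c / 2 * n%:R).
  by rewrite -expRD; congr expR; lra.
rewrite -natr1 cE.
set E := expR (c / 2 * n%:R) in X1 X2 *.
have E1 : 1 <= E by rewrite -expR0 ler_expR mulr_ge0// ltW.
have : (C * n%:R `^ (alpha + gamma + 1)) ^+ k n * (1 + vol n) <= E * (1 + E).
  rewrite ler_pM ?lerD2l// ?addr_ge0 ?(ltW (v0 n n0))//.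
  by rewrite exprn_ge0// mulr_ge0 ?powR_ge0 ?ltW.
have EE : E <= E * E by rewrite ler_peMr//; lra.
lra.
Unshelve. all: by end_near. Qed.

Lemma near_expRN_le (c a eta : R) : 0 < c -> 0 < a -> 0 < eta ->
  \forall n \near \oo, a * expR (- (c * n%:R)) <= eta.
Proof.
move=> c0 a0 e0; near=> n.
have nge : a / (c * eta) <= n%:R by near: n; exact: nbhs_infty_ger.
rewrite expRN ler_pdivrMr ?expR_gt0//.
rewrite ler_pdivrMr ?mulr_gt0// in nge.
have : eta * (1 + c * n%:R) <= eta * expR (c * n%:R).
  by rewrite ler_wpM2l ?expR_ge1Dx// ltW.
lra.
Unshelve. all: by end_near. Qed.

End net_cardinality.

(** * Uniform convergence and the diagonal procedure *)

(** Hypothesis (i) speaks of whole sequences F_n; to use it for one F at one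
stage, put F in a sequence that is constantly some other choice elsewhere. *)
Lemma sequence_through (T : nat -> Type) (A : forall i, set (T i))
    (G : forall i, T i) n (x : T n) :
  (forall i, (0 < i)%N -> A i (G i)) -> A n x ->
  exists H : forall i, T i, (forall i, (0 < i)%N -> A i (H i)) /\ H n = x.
Proof.
move=> AG Ax.
exists (fun i => if pselect (n = i) is left E then eq_rect n T x i E else G i).
split => [i i0|]; case: pselect => // E.
- by case: _ / E.
- exact: AG.
- by rewrite (eq_irrelevance E erefl).
Qed.

Section diagonal_procedure.
Variables (R : realType) (m : nat -> nat).
Variables (FF : forall n, set (probability (obs R (m n)) R)).
Variables (L : forall n, probability (obs R (m n)) R -> 'rV[R]_(m n) -> \bar R).
Variables (bstar : forall n, probability (obs R (m n)) R -> 'rV[R]_(m n)).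
Arguments FF : clear implicits.
Arguments L : clear implicits.
Arguments bstar : clear implicits.

Lemma sup_excess_cvg0 (e : R)
    (bhat : forall n, n.-tuple (obs R (m n)) -> 'rV[R]_(m n)) :
  (forall n, (0 < n)%N -> FF n !=set0) ->
  (forall eta : R, 0 < eta -> \forall n \near \oo, forall F, FF n F ->
    (sample_law F n (excess_event (L n F) (bstar n F) e (@bhat n))
       <= eta%:E)%E) ->
  ereal_sup [set sample_law F n (excess_event (L n F) (bstar n F) e (@bhat n))
            | F in FF n] @[n --> \oo] --> 0%E.
Proof.
move=> FF_nonempty small; set u := fun n => ereal_sup _.
have u0 n : (0 < n)%N -> (0 <= u n)%E.
  move=> /FF_nonempty[F FFF]; apply: le_ereal_sup_tmp.
  by eexists; [exists F; [exact: FFF|reflexivity]|exact: measure_ge0].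
have uE (eta : R) : 0 < eta -> \forall n \near \oo, (u n <= eta%:E)%E.
  move=> /small; apply: filterS => n Fn.
  by apply: ge_ereal_sup => _ [F FFF <-]; exact: Fn.
apply/fine_cvgP; split.
  near=> n; have n0 : (0 < n)%N by near: n; exact: nbhs_infty_gt.
  rewrite ge0_fin_numE ?u0// (@le_lt_trans _ _ 1%:E) ?ltry//.
  by near: n; exact: uE.
apply/cvgr0Pnorm_le => eta eta0; near=> n.
have n0 : (0 < n)%N by near: n; exact: nbhs_infty_gt.
have un : (u n <= eta%:E)%E by near: n; exact: uE.
rewrite /= ger0_norm ?fine_ge0 ?u0// -lee_fin fineK//.
by rewrite ge0_fin_numE ?u0// (le_lt_trans un) ?ltry.
Unshelve. all: by end_near. Qed.

(** At stage n use the procedure of the largest index j <= n that is already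
uniformly good.  As every index is eventually good, J n tends to infinity. *)
Lemma persistent_diagonal
    (bh : nat -> forall n, n.-tuple (obs R (m n)) -> 'rV[R]_(m n)) :
  (forall n, (0 < n)%N -> FF n !=set0) ->
  (forall j n F e, (0 < n)%N -> FF n F ->
     measurable (excess_event (L n F) (bstar n F) e (@bh j n))) ->
  (forall j (eta : R), 0 < eta -> \forall n \near \oo, forall F, FF n F ->
    (sample_law F n (excess_event (L n F) (bstar n F) j.+1%:R^-1 (@bh j n))
       <= eta%:E)%E) ->
  exists J : nat -> nat, persistent FF L bstar (fun n => @bh (J n) n).
Proof.
move=> FF_nonempty mbh small.
pose Q n j := `[< forall F, FF n F ->
  (sample_law F n (excess_event (L n F) (bstar n F) j.+1%:R^-1 (@bh j n))
     <= j.+1%:R^-1%:E)%E >].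
pose J n := (\max_(j < n.+1 | Q n j) j)%N.
have JQ n j : (j <= n)%N -> Q n j -> (j <= J n)%N /\ Q n (J n).
  move=> jn Qj; have jn1 : (j < n.+1)%N by [].
  have Pj : Q n (Ordinal jn1) by [].
  split.
    exact: (@leq_bigmax_cond _ (fun i : 'I_n.+1 => Q n i) _ (Ordinal jn1)).
  have A0 : (0 < #|[pred i : 'I_n.+1 | Q n i]|)%N.
    by apply/card_gt0P; exists (Ordinal jn1); exact: Pj.
  by have [i Qi Ji] := eq_bigmax_cond (@nat_of_ord n.+1) A0; rewrite /J Ji.
exists J => e e0; split; first by move=> n F n0 FFF; exact: mbh.
apply: sup_excess_cvg0 => // eta eta0.
have [j [je jeta]] : exists j, j.+1%:R^-1 <= e /\ j.+1%:R^-1 <= eta.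
  pose c := Num.min e eta.
  have c0 : 0 < c by rewrite lt_min e0.
  exists (Num.truncn c^-1).
  have : (Num.truncn c^-1).+1%:R^-1 <= c.
    by rewrite invf_ple ?posrE// ltW// truncnS_gt.
  by rewrite le_min => /andP.
have j0 : 0 < j.+1%:R^-1 :> R by rewrite invr_gt0.
near=> n => F FFF.
have n0 : (0 < n)%N by near: n; exact: nbhs_infty_gt.
have [jJ /asboolP QJ] : (j <= J n)%N /\ Q n (J n).
  apply: JQ; first by near: n; exact: nbhs_infty_ge.
  by apply/asboolP; near: n; exact: small.
have Jj : (J n).+1%:R^-1 <= j.+1%:R^-1 :> R.
  by rewrite lef_pV2 ?posrE// ler_nat.
apply: (@le_trans _ _ (J n).+1%:R^-1%:E); last first.
  by rewrite lee_fin (le_trans Jj).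
apply: le_trans (QJ F FFF); apply: le_measure; rewrite ?inE; try exact: mbh.
move=> z; rewrite /excess_event/=; apply: le_lt_trans.
by rewrite lee_fin (le_trans Jj).
Unshelve. all: by end_near. Qed.

End diagonal_procedure.

Theorem theorem1 (R : realType) (alpha : R) (halpha : 1 < alpha)
  (FF : forall n, set (probability (obs R (array_dim alpha n)) R))
  (FF_nonempty : forall n, (0 < n)%N -> FF n !=set0)
  (B : forall n, set 'rV[R]_(array_dim alpha n))
  (g : forall n, 'rV[R]_(array_dim alpha n) ->
    (array_dim alpha n).-tuple (measurableTypeR R) -> R)
  (l : R -> R -> R)
  (l_ge0 : forall y p, 0 <= l y p)
  (l_meas : forall n b, (0 < n)%N -> B n b ->
    measurable_fun setT (pred_loss l (@g n) b))
  (bstar : forall n, probability (obs R (array_dim alpha n)) R -> 'rV[R]_(array_dim alpha n))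
  (k : nat -> nat) (vol : nat -> R) :
  let L := fun n => risk (pred_loss l (@g n)) in
  (forall n F, (0 < n)%N -> FF n F -> is_argmin (B n) (L n F) (bstar n F)) ->
  (forall e : R, 0 < e -> exists M : R, \forall n \near \oo,
     forall F b, FF n F -> B n b ->
       (L n F b > L n F (bstar n F) + (2 * e)%:E)%E ->
       (trunc_risk (pred_loss l (@g n)) M F b > L n F (bstar n F) + e%:E)%E) ->
  (forall n, (0 < n)%N -> (0 < k n)%N) ->
  (fun n => (k n)%:R : R^o) =o_\oo (fun n => n%:R / ln n%:R : R^o) ->
  (forall n, (0 < n)%N -> 0 < vol n) ->
  (fun n => ln (vol n) : R^o) =o_\oo (fun n => n%:R : R^o) ->
  (forall F : forall n, probability (obs R (array_dim alpha n)) R,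
     (forall n, (0 < n)%N -> FF n (F n)) ->
     forall n, (0 < n)%N ->
       exists2 C, is_cube (k n) 0 (vol n) C & C (bstar n (F n))) ->
  (forall e : R, 0 < e -> exists delta gamma : R, [/\ 0 < delta, 0 < gamma &
     forall n F b b', (0 < n)%N -> FF n F ->
       sparse (B n) (k n) b -> sparse (B n) (k n) b' ->
       l2norm (b - b') < delta * n%:R `^ (- gamma) ->
       ereal_close e (L n F b) (L n F b')]) ->
  (forall e : R, 0 < e ->
     exists2 bhat : forall n,
         n.-tuple (obs R (array_dim alpha n)) -> 'rV[R]_(array_dim alpha n),
       (forall n, (0 < n)%N -> is_procedure (B n) (bhat n)) &
       excess_vanishes FF L bstar e bhat) /\
  (exists2 bhat : forall n,
         n.-tuple (obs R (array_dim alpha n)) -> 'rV[R]_(array_dim alpha n),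
       (forall n, (0 < n)%N -> is_procedure (B n) (bhat n)) &
       persistent FF L bstar bhat).
Proof.
move=> L Bstar sep k0 ko v0 vo cubeP close.
(* The hypotheses constrain F_n for n > 0 only; at stage 0 take a Dirac mass. *)
have exG i : exists G : probability (obs R (array_dim alpha i)) R,
    (0 < i)%N -> FF i G.
  have [->|/FF_nonempty[G FG]] := posnP i; last by exists G.
  by exists (dirac ((0, [tuple of nseq _ 0]) : obs R _)).
pose G i := projT1 (cid (exG i)).
have FFG i : (0 < i)%N -> FF i (G i) by exact: projT2 (cid (exG i)).
have main (e : R) : 0 < e -> exists bhat : forall n,
    n.-tuple (obs R (array_dim alpha n)) -> 'rV[R]_(array_dim alpha n),
  [/\ forall n, (0 < n)%N -> is_procedure (B n) (bhat n),
    forall n F e', (0 < n)%N -> FF n F ->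
      measurable (excess_event (L n F) (bstar n F) e' (bhat n)) &
    forall eta : R, 0 < eta -> \forall n \near \oo, forall F, FF n F ->
      (sample_law F n (excess_event (L n F) (bstar n F) e (bhat n))
         <= eta%:E)%E].
  move=> e0.
  have [delta [gamma [d0 g0 closeP]]] := close _ (divr_gt0 e0 (ltr0n _ 8)).
  have [M0 sepM0] := sep _ (divr_gt0 e0 (ltr0n _ 2)).
  (* The level given by the truncation condition may be too small, even
     negative, for the deviation bound; raising it preserves the condition. *)
  pose M := Num.max M0 e.
  have eM : e <= M by rewrite le_max lexx orbT.
  have lb0 n b z : 0 <= pred_loss l (@g n) b z by exact: l_ge0.
  have cubeF n F : (0 < n)%N -> FF n F ->
      exists2 C, is_cube (k n) 0 (vol n) C & C (bstar n F).
    move=> n0 FFF.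
    have [H [HF <-]] := sequence_through FFG FFF.
    exact: cubeP.
  pose c : R := (e / 8) ^+ 2 / (8 * M ^+ 2).
  have M_gt0 : 0 < M by exact: lt_le_trans eM.
  have c0 : 0 < c by rewrite divr_gt0 ?mulr_gt0 ?exprn_gt0 ?divr_gt0.
  have perN n : exists bhat : n.-tuple (obs R (array_dim alpha n)) ->
      'rV[R]_(array_dim alpha n), (0 < n)%N ->
     [/\ is_procedure (B n) bhat,
      forall F e', FF n F ->
        measurable (excess_event (L n F) (bstar n F) e' bhat) &
      exists r, [/\ 0 < r, (2 * r) ^+ k n = vol n &
        forall F, FF n F ->
          (forall b, B n b -> (L n F b > L n F (bstar n F) + e%:E)%E ->
            (trunc_risk (pred_loss l (@g n)) M F b >
               L n F (bstar n F) + (e / 2)%:E)%E) ->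
          (sample_law F n (excess_event (L n F) (bstar n F) e bhat) <=
           ((cube_net_size (array_dim alpha n) (k n) r
              (delta * n%:R `^ (- gamma) / (2 * (k n)%:R))).+1%:R *
            expR (- (n%:R * c)))%:E)%E]].
    have [->|n0] := posnP n; first by exists (fun=> 0).
    have nR0 : 0 < n%:R :> R by rewrite ltr0n.
    have [bhat bhatP] := @erm_over_net R (array_dim alpha n) n (k n) (FF n)
      (B n) (pred_loss l (@g n)) (bstar n) (vol n)
      (delta * n%:R `^ (- gamma)) e M
      (FF_nonempty n n0) (@lb0 n) (fun b => l_meas n b n0)
      (fun F => Bstar n F n0) (k0 n n0) (fun F => cubeF n F n0)
      (mulr_gt0 d0 (powR_gt0 _ nR0)) e0 eM
      (fun F b b' => closeP n F b b' n0).
    by exists bhat.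
  exists (fun n => projT1 (cid (perN n))); split.
  - by move=> n n0; case: (cid _) => /= bhat /(_ n0)[].
  - by move=> n F e' n0; case: (cid _) => /= bhat /(_ n0)[_ + _]; apply.
  move=> eta eta0.
  have c20 : 0 < c / 2 by rewrite divr_gt0.
  have cardS := net_card_subexponential alpha g0 d0 c20 k0 ko v0 vo.
  have tail := near_expRN_le c20 (ltr0n R 3 : 0 < 3) eta0.
  have [N _ nearN] := filterI (filterI (nbhs_infty_gt 0) sepM0)
    (filterI cardS tail).
  exists N => // n /nearN[[n0 sepn] [cardn tailn]] F FFF.
  case: (cid _) => /= bhat /(_ n0)[_ _ [r [r0 rv]]] /(_ F FFF) bnd.
  apply: (le_trans (bnd _)) => [b Bb Lb|].
    have mlb : measurable_fun setT (pred_loss l (@g n) b) by exact: l_meas.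
    have M0M : M0 <= M by rewrite le_max lexx.
    apply: lt_le_trans (trunc_risk_le F (lb0 n) mlb (ltW M_gt0) M0M).
    apply: sepn => //; rewrite (_ : 2 * (e / 2) = e)//; lra.
  rewrite lee_fin.
  apply: (@le_trans _ _ (3 * expR (c / 2 * n%:R) * expR (- (n%:R * c)))).
    by apply: ler_wpM2r; [exact: expR_ge0|exact: cardn].
  by rewrite -mulrA -expRD (_ : _ + _ = - (c / 2 * n%:R)); last lra.
split=> [e /main[bhat [pb mb sb]]|].
  exists bhat => //; split; first by move=> n F n0; exact: mb.
  exact: sup_excess_cvg0.
have e_gt0 j : 0 < j.+1%:R^-1 :> R by rewrite invr_gt0.
pose bh j := projT1 (cid (main _ (e_gt0 j))).
have bhP j := projT2 (cid (main _ (e_gt0 j))).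
have [|j eta eta0|J pJ] :=
  @persistent_diagonal R (array_dim alpha) FF L bstar bh FF_nonempty.
- by move=> j; have [_ mb _] := bhP j; exact: mb.
- by have [_ _ sb] := bhP j; exact: sb.
exists (fun n => bh (J n) n) => // n n0.
by have [pb _ _] := bhP (J n); exact: pb.
Qed.
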